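(* For all integers $k$ and $n$ with $3\leq k\leq n$, there exists a real symmetric matrix $M\in\mathbb{R}^{n\times n}$ having exactly $k$ distinct eigenvalues such that $M$ has no nonnegative eigenvector, i.e. there is no nonzero vector $x\in\mathbb{R}^n$ with $x_i\geq 0$ for all $i=1,\dots,n$ that is an eigenvector of $M$.
   Context: A vector $x\in\mathbb{R}^n$ is called nonnegative if all of its components (in the standard basis) are nonnegative. Eigenvectors are nonzero by definition. *)

(* Defs.v *)
From mathcomp Require Import all_boot all_order all_algebra.
From mathcomp Require Import all_classical all_reals.

Set Implicit Arguments.
Unset Strict Implicit.
Unset Printing Implicit Defensive.

Import Order.TTheory GRing.Theory Num.Theory.
Local Open Scope ring_scope.

Definition eigenvector (R : realType) (n : nat) (M : 'M[R]_n) (x : 'cV[R]_n)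
    : Prop :=
  x != 0 /\ exists a : R, M *m x = a *: x.

Definition nonneg_vector (R : realType) (n : nat) (x : 'cV[R]_n) : Prop :=
  forall i : 'I_n, 0 <= x i ord0.

(* [eigenvalue] of mxalgebra is defined with row vectors acted on from the
   right; a matrix and its transpose have the same eigenvalues. *)
Definition eigenvalue_set (R : realType) (n : nat) (M : 'M[R]_n) : set R :=
  [set a | eigenvalue M a]%classic.

(* Main.v *)
Require Import Defs.
From mathcomp Require Import all_boot all_order all_algebra.
From mathcomp Require Import all_classical all_reals.
From mathcomp Require Import ring lra.

Set Implicit Arguments.
Unset Strict Implicit.
Unset Printing Implicit Defensive.

Import Order.TTheory GRing.Theory Num.Theory.
Local Open Scope ring_scope.

(** The matrix is [H D H], where [D] is diagonal with [k] distinct entries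
    and [H] is the reflection in the line of a positive vector [v], so that the
    columns of [H] form an orthonormal basis of eigenvectors.  Give the index [i] the
    weight [v_i ^ 2].  If [x] is nonnegative and nonzero, the coordinates of [x]
    in that basis are [t v_i - x_i], where [t > 0] is twice the coefficient of
    the projection of [x] on [v].  On the indices where they vanish, [x] is equal
    to [t v]; since the other entries of [x] are nonnegative, these indices
    carry at most half of the total weight ([half_weight]).  For an eigenvector,
    the coordinates vanish outside one level set of the diagonal of [D], and that
    level set therefore carries at least half of the weight.  Scaling [v] so
    that each of the [k >= 3] level sets has weight 1, out of a total of [k],
    rules this out ([exists_balanced_weights]). *)

Definition sqnorm (R : realType) (n : nat) (v : 'cV[R]_n) : R :=
  \sum_i v i ord0 ^+ 2.

(** The symmetric involution that is the identity on the line of [v] and minus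
    the identity on its orthogonal complement. *)
Definition reflection (R : realType) (n : nat) (v : 'cV[R]_n) : 'M[R]_n :=
  (2 / sqnorm v) *: (v *m v^T) - 1%:M.

Lemma tr_reflection (R : realType) (n : nat) (v : 'cV[R]_n) :
  (reflection v)^T = reflection v.
Proof. by rewrite /reflection linearB linearZ /= trmx_mul trmxK tr_scalar_mx. Qed.

Lemma reflectionK (R : realType) (n : nat) (v : 'cV[R]_n) :
  sqnorm v != 0 -> reflection v *m reflection v = 1%:M.
Proof.
move=> s0.
have vv : v^T *m v = (sqnorm v)%:M.
  apply/matrixP => i j; rewrite !ord1 !mxE eqxx mulr1n.
  by apply: eq_bigr => l _; rewrite !mxE expr2.
rewrite /reflection; set A := _ *: _.
have AA : A *m A = A + A.
  rewrite /A -scalemxAl -scalemxAr mulmxA -(mulmxA v) vv mul_mx_scalar.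
  rewrite -scalemxAl !scalerA -mulrA divfK //.
  by rewrite -mulr2n -[in RHS]scaler_nat scalerA [_^-1 * _]mulrC.
by rewrite mulmxBl mul1mx mulmxBr mulmx1 AA addrK opprB addrC subrK.
Qed.

Lemma reflection_mulE (R : realType) (n : nat) (v x : 'cV[R]_n) (i : 'I_n) :
  (reflection v *m x) i ord0 =
  2 / sqnorm v * (\sum_j v j ord0 * x j ord0) * v i ord0 - x i ord0.
Proof.
rewrite /reflection mulmxBl mul1mx -scalemxAl -mulmxA !mxE big_ord1 !mxE.
rewrite -mulrA (mulrC (v i ord0)); congr (_ * (_ * _) - _).
by apply: eq_bigr => j _; rewrite mxE.
Qed.

(** On [T] the vector [x] equals [t v] with [t = 2 <v, x> / sqnorm v > 0], so
    the part of [<v, x> = t (sqnorm v) / 2] coming from [T] is [t] times the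
    weight of [T], and the remaining part is nonnegative. *)
Lemma half_weight (R : realType) (n : nat) (v x : 'cV[R]_n) (T : pred 'I_n) :
    (forall i, 0 < v i ord0) -> nonneg_vector x -> x != 0 ->
    (forall i, T i -> (reflection v *m x) i ord0 = 0) ->
  2 * (\sum_(i | T i) v i ord0 ^+ 2) <= sqnorm v.
Proof.
move=> v0 x0 xn0 yT.
set s := sqnorm v; set p := \sum_j v j ord0 * x j ord0.
have [j xj] : exists j, x j ord0 != 0.
  apply/existsP; apply: contra_neqT xn0; rewrite negb_exists => /forallP xE.
  by apply/matrixP => i j; rewrite ord1 mxE; apply/eqP; move: (xE i); rewrite negbK.
have p0 : 0 < p.
  rewrite /p (bigD1 j) //= ltr_pwDl //.
    by rewrite mulr_gt0 // lt_neqAle eq_sym xj x0.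
  by apply: sumr_ge0 => i _; rewrite mulr_ge0 // ltW.
have s0 : 0 < s.
  rewrite /s /sqnorm (bigD1 j) //= ltr_pwDl ?exprn_gt0 //.
  by apply: sumr_ge0 => i _; rewrite sqr_ge0.
have pT : 2 / s * p * (\sum_(i | T i) v i ord0 ^+ 2) <= p.
  rewrite [leRHS](bigID T) /= mulr_sumr.
  rewrite -[leLHS]addr0 lerD //; last first.
    by apply: sumr_ge0 => i _; rewrite mulr_ge0 // ltW.
  apply: ler_sum => i /yT; rewrite reflection_mulE -/s -/p => /eqP.
  by rewrite subr_eq0 => /eqP <-; rewrite expr2 mulrA mulrC.
rewrite -(ler_pM2r s0) in pT; rewrite -(ler_pM2l p0).
suff -> : p * (2 * \sum_(i | T i) v i ord0 ^+ 2) =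
    2 / s * p * (\sum_(i | T i) v i ord0 ^+ 2) * s by [].
by field; rewrite gt_eqF.
Qed.

Lemma eigenvalue_set_conj_diag (R : realType) (n : nat) (P : 'M[R]_n)
    (d : 'rV[R]_n) :
  P *m P = 1%:M ->
  eigenvalue_set (P *m diag_mx d *m P) = [set d ord0 i | i in setT]%classic.
Proof.
move=> PP; apply/seteqP; split => a /=.
  move=> /eigenvalueP [u uM u0].
  have wD : u *m P *m diag_mx d = a *: (u *m P).
    by rewrite scalemxAl -uM -!mulmxA PP mulmx1.
  have w0 : u *m P != 0.
    by apply: contra_neq u0 => uP; rewrite -[u]mulmx1 -PP mulmxA uP mul0mx.
  have [j wj] := rV0Pn _ w0.
  exists j => //; move/matrixP/(_ ord0 j): wD.
  rewrite mul_mx_diag mxE [RHS]mxE mulrC.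
  exact: (mulIf wj).
move=> [i _ <-]; apply/eigenvalueP; exists (delta_mx ord0 i *m P).
  rewrite !mulmxA -[delta_mx _ _ *m P *m P]mulmxA PP mulmx1 scalemxAl; congr (_ *m _).
  apply/matrixP => r j; rewrite mul_mx_diag !mxE.
  by case: (j =P i) => [->|]; rewrite ?andbF ?mul0r ?mulr0 // mulrC.
apply/eqP => e0.
have /matrixP/(_ ord0 i) : delta_mx ord0 i = 0 :> 'rV[R]_n.
  by rewrite -[LHS]mulmx1 -PP mulmxA e0 mul0mx.
by rewrite !mxE !eqxx => /eqP; rewrite oner_eq0.
Qed.

Lemma eigenvector_conj_diag (R : realType) (n : nat) (P : 'M[R]_n)
    (d : 'rV[R]_n) (x : 'cV[R]_n) :
    P *m P = 1%:M -> eigenvector (P *m diag_mx d *m P) x ->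
  exists j, forall i, d ord0 i != d ord0 j -> (P *m x) i ord0 = 0.
Proof.
move=> PP [x0 [a Mx]].
have Dy : diag_mx d *m (P *m x) = a *: (P *m x).
  by rewrite scalemxAr -Mx !mulmxA PP mul1mx.
have y0 : P *m x != 0.
  by apply: contra_neq x0 => Px; rewrite -[x]mul1mx -PP -mulmxA Px mulmx0.
have dy i : d ord0 i * (P *m x) i ord0 = a * (P *m x) i ord0.
  by move/matrixP/(_ i ord0): Dy; rewrite mul_diag_mx mxE [RHS]mxE.
have [j yj] := cV0Pn _ y0; exists j => i.
have aj : d ord0 j = a by apply: (mulIf yj); exact: dy.
rewrite aj; apply: contra_neq_eq => yi; apply: (mulIf yi); exact: dy.
Qed.

(** The weight [v_i ^ 2] is [1 / q], where [q] is the number of indices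
    of the same colour as [i]. *)
Lemma exists_balanced_weights (R : realType) (n : nat) (C : finType)
    (c : 'I_n -> C) :
    (forall a, exists i, c i = a) ->
  exists v : 'cV[R]_n, (forall i, 0 < v i ord0) /\
    forall a, \sum_(i | c i == a) v i ord0 ^+ 2 = 1.
Proof.
move=> c_surj; pose q a := #|[pred i | c i == a]|.
have q0 a : (0 < (q a)%:R :> R).
  by rewrite ltr0n; have [i ci] := c_surj a; apply/card_gt0P; exists i; apply/eqP.
exists (\col_i Num.sqrt (q (c i))%:R^-1); split=> [i|a].
  by rewrite mxE sqrtr_gt0 invr_gt0.
rewrite (eq_bigr (fun=> (q a)%:R^-1)) => [|i /eqP ci].
  by rewrite sumr_const -/(q a) -[LHS]mulr_natl divff // gt_eqF.
by rewrite mxE sqr_sqrtr ci // invr_ge0 ltW.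
Qed.

Theorem mainTheorem3 (R : realType) (k n : nat) (hk : (3 <= k)%N)
    (hkn : (k <= n)%N) :
  exists M : 'M[R]_n,
    [/\ M^T = M,
        (eigenvalue_set M #= `I_k)%card &
        ~ (exists x : 'cV[R]_n, nonneg_vector x /\ eigenvector M x)].
Proof.
have k0 : (0 < k)%N by apply: leq_trans hk.
have c_lt (i : 'I_n) : (minn i k.-1 < k)%N.
  by rewrite (leq_ltn_trans (geq_minr _ _)) // prednK.
(* Any surjection onto [k] colours would do: the colours are the eigenvalues,
   and their classes index orthonormal bases of the eigenspaces. *)
pose c (i : 'I_n) : 'I_k := Ordinal (c_lt i).
have c_surj a : exists i, c i = a.
  exists (widen_ord hkn a); apply/val_inj => /=.
  by apply/minn_idPl; rewrite -ltnS prednK.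
have [v [v_gt0 v_bal]] := exists_balanced_weights R c_surj.
have v_norm : sqnorm v = k%:R.
  rewrite /sqnorm (partition_big c predT) //= (eq_bigr (fun=> 1)) //.
  by rewrite sumr_const card_ord.
have HH : reflection v *m reflection v = 1%:M.
  by apply: reflectionK; rewrite v_norm pnatr_eq0 -lt0n.
pose d : 'rV[R]_n := \row_i (c i)%:R.
exists (reflection v *m diag_mx d *m reflection v); split.
- by rewrite !trmx_mul tr_reflection tr_diag_mx mulmxA.
- rewrite eigenvalue_set_conj_diag //.
  have -> : [set d ord0 i | i in setT]%classic
      = [set l%:R | l in `I_k]%classic :> set R.
    apply/seteqP; split => a /= [].
      by move=> i _ <-; exists (c i); rewrite ?mxE //=.
    move=> l lk <-; have [i ci] := c_surj (Ordinal lk).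
    by exists i => //; rewrite mxE ci.
  by apply: inj_card_eq => l m _ _ /eqP; rewrite eqr_nat => /eqP.
- move=> [x [x_ge0 x_eig]].
  have [j y0] := eigenvector_conj_diag HH x_eig.
  (* All colours but that of [j] have total weight [k - 1], more than [k / 2]. *)
  have := half_weight (T := [pred i | c i != c j]) v_gt0 x_ge0 x_eig.1.
  have -> : \sum_(i | [pred i | c i != c j] i) v i ord0 ^+ 2 = k%:R - 1.
    rewrite -v_norm /sqnorm [in RHS](bigID (fun i => c i == c j)) /= v_bal.
    by rewrite addrC addrK.
  have k3 : 3 <= k%:R :> R by rewrite ler_nat.
  rewrite v_norm => le_k; have : 2 * (k%:R - 1) <= k%:R :> R.
    by apply: le_k => i /= ci; apply: y0; rewrite !mxE eqr_nat.
  lra.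
Qed.
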